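(* Let $D=(V,E)$ be a finite digraph (parallel edges allowed, no loops) and let $r\in V$, where no edge of $D$ has head $r$. Then \[ \mathcal{F}_{D,r}:=\{ E(F) \mid F\subseteq D \text{ is an } r\text{-flame} \} \] is a greedoid on $E$. Furthermore, for each $\subseteq$-maximal element $E(F^{*})$ of $\mathcal{F}_{D,r}$ we have $\lambda_{F^{*}}(r,v)=\lambda_D(r,v)$ for all $v\in V-r$.
   Context: Subdigraphs $F\subseteq D$ are taken on the vertex set $V$ with $E(F)\subseteq E$. For a digraph $H$ on $V$ and $v\in V-r$, $\lambda_H(r,v)$ denotes the local edge-connectivity from $r$ to $v$ in $H$, i.e. the maximal number of pairwise edge-disjoint directed $r\to v$ paths in $H$, and $\varrho_H(v)$ denotes the in-degree of $v$ in $H$. A digraph $F$ on $V$ is an $r$-flame if $\varrho_F(v)=\lambda_F(r,v)$ for every $v\in V-r$. A family $\mathcal{F}\subseteq 2^E$ is a greedoid on $E$ if $\varnothing\in\mathcal{F}$ and whenever $F,F'\in\mathcal{F}$ with $|F|<|F'|$ there is $e\in F'\setminus F$ with $F\cup\{e\}\in\mathcal{F}$. *)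

(* Defs.v *)
From HB Require Import structures.
From mathcomp Require Import all_boot.

Set Implicit Arguments.
Unset Strict Implicit.
Unset Printing Implicit Defensive.

(* The edges form an abstract finite type, so parallel edges are allowed. A
   subdigraph keeps all the vertices and is represented by its edge set
   H : {set E}; the whole digraph is [set: E]. *)
Record digraph (V E : finType) := Digraph {
  etail : E -> V;
  ehead : E -> V;
  loopless : forall e : E, etail e != ehead e
}.

Fixpoint diwalk (V E : finType) (D : digraph V E) (x : V) (p : seq E) (y : V)
  : bool :=
  if p is e :: p' then (etail D e == x) && diwalk D (ehead D e) p' y
  else x == y.

(* The vertices visited by the walk p from x are x and the heads of its edges. *)
Definition dipath (V E : finType) (D : digraph V E) (H : {set E})
    (x : V) (p : seq E) (y : V) : bool :=
  [&& diwalk D x p y, uniq (x :: map (ehead D) p) & all [in H] p].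

Definition indeg (V E : finType) (D : digraph V E) (H : {set E}) (v : V) : nat :=
  #|[set e in H | ehead D e == v]|.

(* A path has no repeated edge, so bounding the length of the sequences by #|E|
   loses no path. For x = y the trivial path counts once; only x != y is
   meaningful. *)
Definition edge_disjoint_paths (V E : finType) (D : digraph V E) (H : {set E})
    (x y : V) (P : {set #|E|.-bseq E}) : bool :=
  [forall p in P, dipath D H x p y] &&
  [forall p in P, forall q in P, (p != q) ==> [disjoint p & q]].

Definition lambda (V E : finType) (D : digraph V E) (H : {set E}) (x y : V)
  : nat :=
  \max_(P : {set #|E|.-bseq E} | edge_disjoint_paths D H x y P) #|P|.

Definition flame (V E : finType) (D : digraph V E) (r : V) (F : {set E}) : bool :=
  [forall v, (v != r) ==> (indeg D F v == lambda D F r v)].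

Definition flames (V E : finType) (D : digraph V E) (r : V) : {set {set E}} :=
  [set F : {set E} | flame D r F].

Definition greedoid (E : finType) (FF : {set {set E}}) : Prop :=
  set0 \in FF /\
  forall F F' : {set E}, F \in FF -> F' \in FF -> #|F| < #|F'| ->
    exists2 e : E, e \in F' :\: F & e |: F \in FF.

(* Main.v *)
(* By Menger's theorem, [F] is an [r]-flame iff every set [X] of vertices
   avoiding [r] is entered by at least [indeg F v] edges of [F], for each
   [v] in [X].  Suppose that [F] is a flame and [lambda F r v < lambda H r v].
   Let [X] be maximal among the sets containing [v], avoiding [r] and entered
   by exactly [indeg F v] edges of [F].  Some edge [e] of [H] outside [F] enters
   [X], and adding [e] keeps [F] a flame: otherwise the tail and the head [u] of
   [e] lie in a set [Y] avoiding [r] and entered by only [indeg F u] edges of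
   [F], and by submodularity [X :|: Y] contradicts the maximality of [X].  Both
   claims follow, with [H] the larger flame for the first and [H] the whole
   digraph for the second. *)

Require Import Defs.
From HB Require Import structures.
From mathcomp Require Import all_boot zify.

Set Implicit Arguments.
Unset Strict Implicit.
Unset Printing Implicit Defensive.

Section Cuts.

Variables (V E : finType) (D : digraph V E).
Implicit Types (H F : {set E}) (X Y : {set V}) (e : E) (x y v r : V).

(** * Edges entering a vertex set, and submodularity of their number *)

Definition enters X e : bool := (ehead D e \in X) && (etail D e \notin X).

Definition cut H X : nat := #|[set e in H | enters X e]|.

Lemma cut_sum H X : cut H X = \sum_(e in H) enters X e.
Proof.
rewrite /cut -sum1_card [RHS]big_mkcond [LHS]big_mkcond /=.
by apply: eq_bigr => e _; rewrite inE; case: (e \in H); case: enters.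
Qed.

(** The inequality holds edge by edge; it is strict only for edges between [X :\: Y] and
    [Y :\: X]. *)
Lemma cut_submod H X Y :
  cut H (X :&: Y) + cut H (X :|: Y) <= cut H X + cut H Y.
Proof.
rewrite !cut_sum -!big_split /=; apply: leq_sum => e _.
rewrite /enters !inE.
by case: (ehead D e \in X); case: (ehead D e \in Y);
   case: (etail D e \in X); case: (etail D e \in Y).
Qed.

Lemma cut_set1 H v : cut H [set v] = indeg D H v.
Proof.
apply: eq_card => e; rewrite !inE /enters !inE.
by case: (ehead D e =P v) => [<-|_] //=; rewrite loopless.
Qed.

Lemma cutU1 H X e : e \notin H -> cut (e |: H) X = enters X e + cut H X.
Proof. by move=> eH; rewrite !cut_sum big_setU1. Qed.

Lemma indegU1 H v e :
  e \notin H -> indeg D (e |: H) v = (ehead D e == v) + indeg D H v.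
Proof.
move=> eH; rewrite -!cut_set1 cutU1 // /enters !inE.
by case: (ehead D e =P v) => [<-|_] //=; rewrite loopless.
Qed.

Lemma cutD1 H X e : e \in H -> cut H X = enters X e + cut (H :\ e) X.
Proof. by move=> eH; rewrite -cutU1 ?setD1K // !inE eqxx. Qed.

(** * Menger's theorem for edge-disjoint paths *)

Lemma diwalk_enters X x p v :
  diwalk D x p v -> x \notin X -> v \in X -> exists2 e, e \in p & enters X e.
Proof.
elim: p x => [|e p IH] x /=; first by move=> /eqP -> /negP.
case/andP=> /eqP <- wp xX vX.
case: (boolP (ehead D e \in X)) => hX.
  by exists e; rewrite ?mem_head // /enters hX.
by have [f fp fX] := IH _ wp hX vX; exists f; rewrite // inE fp orbT.
Qed.

Lemma lambda_le_cut H X r v :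
  v \in X -> r \notin X -> lambda D H r v <= cut H X.
Proof.
move=> vX rX; apply/bigmax_leqP => P /andP[/forall_inP pathP /forall_inP disjP].
have entP (p : #|E|.-bseq E) : p \in P ->
    exists e, [&& e \in p, e \in H & enters X e].
  move=> /pathP /and3P[wp _ /allP pH].
  have [e ep eX] := diwalk_enters wp rX vX.
  by exists e; rewrite ep eX pH.
case: (pickP (mem P)) => [p0 p0P|P0]; last by rewrite eq_card0.
have [e0 _] := entP _ p0P.
(* Sending each path to an edge by which it enters [X] is injective by disjointness. The default
   [e0] is never taken on [P]. *)
pose f (p : #|E|.-bseq E) := odflt e0 [pick e | [&& e \in p, e \in H & enters X e]].
have fP p : p \in P -> [&& f p \in p, f p \in H & enters X (f p)].
  move=> /entP [e eP]; rewrite /f; case: pickP => [//|/(_ e)].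
  by rewrite eP.
rewrite -(card_in_imset (f := f)); last first.
  move=> p q pP qP fpq; apply/eqP; apply: contraT => npq.
  have /forall_inP/(_ _ qP)/implyP/(_ npq) := disjP _ pP.
  have /andP[fp _] := fP _ pP; have /andP[fq _] := fP _ qP.
  by rewrite disjoint_has => /hasPn/(_ _ fp); rewrite fpq fq.
apply/subset_leq_card/subsetP => _ /imsetP[p pP ->].
by have /and3P[_ fH fX] := fP _ pP; rewrite inE fH.
Qed.

(* A form of Menger's theorem suited to induction on [#|H|]: tokens [ts] sit on
   vertices, and a token on [x != v] moves along an edge that stays in the
   smallest tight set containing [x] and [v]. *)
Lemma token_walks H (ts : seq V) v :
  (forall X, v \in X -> size ts <= count [in X] ts + cut H X) ->
  exists ps : seq (V * seq E),
    [/\ perm_eq (map fst ps) ts,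
        all (fun xp => diwalk D xp.1 xp.2 v) ps,
        uniq (flatten (map snd ps)) &
        {subset flatten (map snd ps) <= H}].
Proof.
elim: {H}_.+1 {-2}H ts (ltnSn #|H|) => // n IHn H ts leHn cutP.
case: (boolP (all (pred1 v) ts)) => [/all_pred1P -> | /allPn[x xts nxv]].
  exists (nseq (size ts) (v, [::])); rewrite !map_nseq /=; split=> //.
  - by rewrite all_nseq /= eqxx orbT.
  - by elim: (size ts).
  - by elim: (size ts).
(* Tight sets attain equality in the cut condition. *)
pose tight X := [&& x \in X, v \in X & count [in X] ts + cut H X <= size ts].
have tightT : tight setT.
  rewrite /tight !inE /= -[leqRHS]addn0 leq_add ?count_size // leqn0.
  by apply/eqP/eq_card0 => e; rewrite !inE /enters !inE andbF.
have [X /minsetP[/and3P[xX vX tX] minX] _] := minset_exists tightT.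
have tightI Y : tight Y -> X \subset Y.
  (* Cuts are submodular and token counts modular, so [X :&: Y] is again tight. *)
  case/and3P=> xY vY tY; apply/setIidPl/minX; last exact: subsetIl.
  rewrite /tight !inE xX xY vX vY /=.
  have := cut_submod H X Y.
  have := cutP (X :|: Y); rewrite inE vX => /(_ isT).
  have := count_predUI [in X] [in Y] ts.
  have <- : count [in X :|: Y] ts = count (predU [in X] [in Y]) ts.
    by apply: eq_count => z; rewrite !inE.
  have <- : count [in X :&: Y] ts = count (predI [in X] [in Y]) ts.
    by apply: eq_count => z; rewrite !inE.
  lia.
have [e /and3P[eH /eqP te he]] :
    exists e, [&& e \in H, etail D e == x & ehead D e \in X].
  case: (pickP (fun e => [&& e \in H, etail D e == x & ehead D e \in X]));
    first by move=> e; exists e.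
  (* Without such an edge, removing [x] from [X] loses a token and gains no entering edge, against
     the cut condition. *)
  move=> noe; suff : count [in X] ts + cut H X < count [in X] ts + cut H X.
    by rewrite ltnn.
  apply: leq_ltn_trans tX (leq_ltn_trans (cutP (X :\ x) _) _).
    by rewrite !inE eq_sym nxv.
  rewrite -addSn leq_add //.
    rewrite -!sum1_count (big_rem x) //= [ltnRHS](big_rem x) //= !inE eqxx xX /=.
    rewrite add0n add1n ltnS ![\sum_(_ <- _ | _) _]sum1_count.
    by apply: sub_count => z; rewrite !inE => /andP[].
  apply/subset_leq_card/subsetP => e; rewrite !inE /enters !inE.
  case/andP=> eH /andP[/andP[_ hX]]; rewrite negb_and negbK hX eH /=.
  by have := noe e; rewrite eH hX andbT /= => ->.
pose y := ehead D e.
have pts := perm_to_rem xts.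
have szts : size (y :: rem x ts) = size ts by rewrite (perm_size pts).
have [] := IHn (H :\ e) (y :: rem x ts).
- by move: leHn; rewrite (cardsD1 e H) eH.
- move=> Y vY; rewrite szts.
  have cY : count [in Y] ts = (x \in Y) + count [in Y] (rem x ts).
    by rewrite (permP pts).
  have := cutP _ vY; rewrite (cutD1 Y eH) cY /= /enters te -/y.
  (* Moving the token along [e] and deleting [e] hurts only sets with [x] inside and [y] outside.
     These do not contain [X], so they are not tight and have one unit to spare. *)
  case: (boolP (x \in Y)) => xY; case: (boolP (y \in Y)) => yY /=; try lia.
  have : ~~ tight Y by apply: contra yY => /tightI/subsetP/(_ _ he).
  rewrite /tight xY vY /= -ltnNge cY (cutD1 Y eH) /enters te -/y (negPf yY) xY /=.
  lia.
move=> ps [pps wps ups sps].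
have /mapP[[y' p] ypps /= yy'] : y \in map fst ps.
  by rewrite (perm_mem pps) mem_head.
rewrite -{}yy' in ypps.
have pps' := perm_to_rem ypps; set qs := rem _ _ in pps'.
have pfl := perm_flatten (perm_map snd pps').
exists ((x, e :: p) :: qs); split=> /=.
- rewrite perm_sym; apply: perm_trans pts _.
  rewrite perm_cons -(perm_cons y) -(permPl pps).
  exact: (perm_map fst pps').
- by move: wps; rewrite (perm_all _ pps') /= te eqxx.
- rewrite -(perm_uniq pfl) ups andbT -(perm_mem pfl).
  by apply/negP => /sps; rewrite !inE eqxx.
- move=> f; rewrite inE -(perm_mem pfl) => /predU1P[-> //|/sps].
  by rewrite inE => /andP[].
Qed.

(** Closed detours are cut out. Only edges of the walk are kept, so disjoint walks yield disjoint
    paths. *)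
Lemma diwalk_shorten x p v :
  diwalk D x p v ->
  exists2 q, diwalk D x q v && uniq (x :: map (ehead D) q) & {subset q <= p}.
Proof.
elim: p x => [|e p IH] x /=; first by move=> xv; exists [::]; rewrite /= ?xv.
case/andP=> /eqP te /IH[q /andP[wq uq] sq].
case: (boolP (x \in ehead D e :: map (ehead D) q)) => xq; last first.
  exists (e :: q) => [|f]; first by rewrite /= te eqxx wq xq.
  by rewrite !inE => /predU1P[->|/sq ->]; rewrite ?eqxx ?orbT.
suff [q' wq' sq'] : exists2 q', diwalk D x q' v && uniq (x :: map (ehead D) q') &
    {subset q' <= q}.
  by exists q' => // f /sq' /sq fp; rewrite inE fp orbT.
(* As [x] recurs on the path [q], the part of [q] after that visit is the path sought. *)
elim: q (ehead D e) wq uq xq {sq} => [|f q IHq] z.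
  by move=> wz uz; rewrite mem_seq1 => /eqP ->; exists [::]; rewrite // wz.
move=> wz uz; rewrite inE => /predU1P[-> | xq]; first by exists (f :: q); rewrite ?wz.
case/andP: wz => _ wf; case/andP: uz => _ uf.
have [q' wq' sq'] := IHq _ wf uf xq.
by exists q' => // g /sq' gq; rewrite inE gq orbT.
Qed.

(** Put [k] tokens on [r]: a set containing [r] meets the cut condition by its tokens alone, any
    other set by hypothesis. *)
Lemma menger H r v k :
  v != r -> (forall X, v \in X -> r \notin X -> k <= cut H X) ->
  k <= lambda D H r v.
Proof.
move=> nvr cutP.
have [X vX|ps [pps wps ups sps]] := @token_walks H (nseq k r) v.
  rewrite size_nseq count_nseq; case: (boolP (r \in X)) => rX /=.
    by rewrite mul1n leq_addr.
  by rewrite mul0n cutP.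
(* The last clause serves the induction: it keeps a new path disjoint from the earlier ones. *)
suff [P [cardP dP _]] : exists P : {set #|E|.-bseq E},
    [/\ #|P| = size ps, edge_disjoint_paths D H r v P &
        forall p e, p \in P -> e \in p -> e \in flatten (map snd ps)].
  rewrite -[leqLHS](size_nseq k r) -(perm_size pps) size_map -cardP.
  exact: (@bigmax_sup _ P).
have {pps}: all (fun xp => xp.1 == r) ps.
  have := perm_all (pred1 r) pps.
  by rewrite all_map all_nseq /= eqxx orbT.
elim: ps wps ups sps => [|[x p] ps IH] /=.
  by move=> _ _ _ _; exists set0; rewrite cards0; split=> // [|p e];
    rewrite ?inE // /edge_disjoint_paths; apply/andP; split;
    apply/forall_inP => p; rewrite inE.
case/andP=> wp wps; rewrite cat_uniq => /and3P[_ npps ups] sps /andP[/eqP xr rps].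
have [|P [cardP /andP[pathP disjP] subP]] := IH wps ups _ rps.
  by move=> f fps; apply: sps; rewrite mem_cat fps orbT.
have [q /andP[wq uq] sq] := diwalk_shorten wp; rewrite xr in wq uq.
have uEq : uniq q by case/andP: uq => _ /map_uniq.
have szq : size q <= #|E| by rewrite -(card_uniqP uEq) max_card.
pose b := Bseq szq.
have bps e : e \in b -> e \notin flatten (map snd ps).
  by move=> /sq ep; apply: contra npps => eps; apply/hasP; exists e.
have bP c : c \in P -> [disjoint b & c].
  move=> cP; rewrite disjoint_has; apply/hasPn => e /bps; apply: contra.
  exact: subP cP.
(* As [v != r], the new path has an edge, so being disjoint from the members of [P] makes it
   distinct from them. *)
have nbP : b \notin P.
  have [e eq] : exists e, e \in q.
    move: wq; case: (q) => [/= rv|e q' _]; first by rewrite eq_sym rv in nvr.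
    by exists e; rewrite mem_head.
  by apply/negP => /bP /disjointFr/(_ eq); rewrite [_ \in _]eq.
exists (b |: P); split.
- by rewrite cardsU1 nbP cardP.
- apply/andP; split; apply/forall_inP => c; rewrite inE in_set1.
    case/predU1P=> [->|]; last exact: (forall_inP pathP).
    rewrite /dipath wq uq /=; apply/allP => e /sq ep.
    by apply: sps; rewrite mem_cat ep.
  case/predU1P=> [->|cP]; apply/forall_inP => d; rewrite inE in_set1;
    case/predU1P=> [->|dP]; apply/implyP => ncd.
  + by rewrite eqxx in ncd.
  + exact: bP.
  + by rewrite disjoint_sym bP.
  + by have /forall_inP/(_ _ dP)/implyP := forall_inP disjP _ cP; apply.
- move=> c e; rewrite inE in_set1 mem_cat => /predU1P[->|cP].
    by move=> /sq ->.
  by move=> /(subP _ _ cP) ->; rewrite orbT.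
Qed.

(** * Flames and their augmentation by one edge *)

Lemma lambda_le_indeg H r v : v != r -> lambda D H r v <= indeg D H v.
Proof.
by move=> nvr; rewrite -cut_set1 lambda_le_cut ?inE // eq_sym.
Qed.

Lemma flameP r F :
  reflect (forall X v, v \in X -> r \notin X -> indeg D F v <= cut F X)
          (flame D r F).
Proof.
apply: (iffP forallP) => [flF X v vX rX | cutF v].
  have nvr : v != r by apply: contraNneq rX => <-.
  by have /implyP/(_ nvr)/eqP -> := flF v; apply: lambda_le_cut.
apply/implyP => nvr; rewrite eqn_leq lambda_le_indeg // andbT.
by apply: menger => // X vX rX; apply: cutF.
Qed.

Lemma flame_augment r F H v :
  flame D r F -> v != r -> lambda D F r v < lambda D H r v ->
  exists2 e, e \in H :\: F & flame D r (e |: F).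
Proof.
move=> flF nvr ltFH; have /flameP cutF := flF.
have {flF} lamF : lambda D F r v = indeg D F v.
  by have /forallP/(_ v)/implyP/(_ nvr)/eqP := flF.
pose tight X := [&& v \in X, r \notin X & cut F X <= indeg D F v].
have tight1 : tight [set v] by rewrite /tight !inE eqxx eq_sym nvr cut_set1 /=.
have [X /maxsetP[/and3P[vX rX tX] maxX] _] := maxset_exists tight1.
(* Otherwise [cut H X <= cut F X], which would bound [lambda D H r v] by [indeg D F v]. *)
have [e eHF eX] : exists2 e, e \in H :\: F & enters X e.
  apply/exists_inP; apply: contraLR ltFH => /exists_inPn noe.
  rewrite -leqNgt lamF; apply: leq_trans (lambda_le_cut H vX rX) _.
  apply: leq_trans tX; apply/subset_leq_card/subsetP => e; rewrite !inE.
  case/andP=> eH eX; rewrite eX andbT; apply: contraLR eX => eF.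
  by apply: noe; rewrite inE eF.
exists e => //; move: eHF; rewrite inE => /andP[eF _].
apply/flameP => Y w wY rY; rewrite cutU1 // indegU1 //.
have cutYw := cutF _ _ wY rY.
(* The bound can fail only if [w] is the head of [e], [e] does not enter [Y], and
   [cut F Y <= indeg D F w]. *)
case: eqP => [hw|_]; last exact: leq_trans (leq_addl _ _).
case: (boolP (enters Y e)) => eY; first by rewrite leq_add2l.
rewrite add0n add1n ltnNge; apply/negP => tY.
case/andP: eX; rewrite hw => wX /negP[].
have {eY} teY : etail D e \in Y by move: eY; rewrite /enters hw wY /= negbK.
suff <- : X :|: Y = X by rewrite inE teY orbT.
apply: maxX; last exact: subsetUl.
(* Since [w] lies in [X :&: Y], that cut is at least [indeg D F w], hence at least [cut F Y];
   submodularity leaves [cut F (X :|: Y) <= cut F X]. *)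
rewrite /tight !inE vX (negPf rX) (negPf rY) /=.
have := cut_submod F X Y.
have := cutF (X :&: Y) w; rewrite !inE wX wY (negPf rX) => /(_ isT isT).
lia.
Qed.

Lemma dipath_sub H H' x p y :
  H \subset H' -> dipath D H x p y -> dipath D H' x p y.
Proof.
move=> sHH' /and3P[wp up /allP pH]; rewrite /dipath wp up /=.
by apply/allP => e /pH; apply: (subsetP sHH').
Qed.

Lemma lambda_mono H H' x y : H \subset H' -> lambda D H x y <= lambda D H' x y.
Proof.
move=> sHH'; apply/bigmax_leqP => P /andP[/forall_inP pathP disjP].
apply: (@bigmax_sup _ P) => //; rewrite /edge_disjoint_paths disjP andbT.
by apply/forall_inP => p /pathP; apply: dipath_sub.
Qed.

Lemma card_indeg r F : (forall e, ehead D e != r) ->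
  #|F| = \sum_(v | v != r) indeg D F v.
Proof.
move=> no_r; rewrite -sum1_card (partition_big (ehead D) (fun v => v != r)) //=.
apply: eq_bigr => v _; rewrite /indeg -sum1_card.
by apply: eq_bigl => e; rewrite inE.
Qed.

End Cuts.

(** * The greedoid property and maximal flames *)

Theorem theorem2 (V E : finType) (D : digraph V E) (r : V)
    (no_edge_into_r : forall e : E, ehead D e != r) :
  greedoid (flames D r) /\
  (forall Fstar : {set E}, maxset [in flames D r] Fstar ->
     forall v : V, v != r -> lambda D Fstar r v = lambda D [set: E] r v).
Proof.
split; [split|].
- rewrite inE; apply/flameP => X v _ _; rewrite /indeg eq_card0 // => e.
  by rewrite !inE.
- move=> F F'; rewrite !inE => flF flF' ltFF'.
  (* No edge enters [r], so the in-degrees at the other vertices sum to the number of edges. In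
     flames they equal [lambda]. *)
  have [v nvr ltv] : exists2 v, v != r & indeg D F v < indeg D F' v.
    apply/exists_inP; apply: contraLR ltFF' => /exists_inPn noe.
    rewrite -leqNgt !(card_indeg _ no_edge_into_r); apply: leq_sum => v nvr.
    by rewrite leqNgt noe.
  have [|e eFF' flFe] := flame_augment (H := F') flF nvr.
    have lamE G : flame D r G -> lambda D G r v = indeg D G v.
      by move=> /forallP/(_ v)/implyP/(_ nvr)/eqP.
    by rewrite !lamE.
  by exists e; rewrite ?inE // -in_setD.
- move=> F /maxsetP[flF maxF] v nvr; rewrite inE in flF.
  apply/eqP; rewrite eqn_leq lambda_mono ?subsetT //= leqNgt; apply/negP => ltF.
  have [e] := flame_augment flF nvr ltF.
  rewrite inE => /andP[/negP eF _] flFe; apply: eF.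
  by rewrite -(maxF (e |: F)) ?subsetUr ?inE ?eqxx.
Qed.
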